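(* The vector fields which generate the Lie algebra of infinitesimal symmetries associated with the \c{T}i\c{t}eica PDE $$\omega_{uv}=e^{\omega}-e^{-2\omega}$$ (for an unknown function $\omega=\omega(u,v)$) are $$U_1=u\frac{\partial}{\partial u}-v\frac{\partial}{\partial v},\qquad U_2=\frac{\partial}{\partial u},\qquad U_3=\frac{\partial}{\partial v}.$$
   Context: Subscripts $u,v$ denote partial derivatives. An infinitesimal symmetry of a second order PDE $\Delta(u,v,\omega^{(2)})=0$ (where $\omega^{(2)}$ denotes $\omega$ and its partial derivatives up to order $2$) is a smooth vector field $X=\zeta(u,v,\omega)\frac{\partial}{\partial u}+\eta(u,v,\omega)\frac{\partial}{\partial v}+\phi(u,v,\omega)\frac{\partial}{\partial\omega}$ such that $\mathrm{pr}^{(2)}X[\Delta]=0$ whenever $\Delta=0$. Here $\mathrm{pr}^{(2)}X=X+\sum_J\phi^J\frac{\partial}{\partial\omega_J}$ over $J\in\{u,v,uu,uv,vv\}$, with $\phi^J=D_J(\phi-\zeta\omega_u-\eta\omega_v)+\zeta\omega_{J,u}+\eta\omega_{J,v}$ and $D_J$ the total derivative; $\omega_{J,u}$, $\omega_{J,v}$ denote the further derivatives of $\omega_J$. *)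

(* Defs.v *)
From Stdlib Require Import Reals List.
From Coquelicot Require Import Coquelicot.
Open Scope R_scope.

(** * Smooth functions of (u, v, w) *)

Inductive coord := Cu | Cv | Cw.

Definition slice (a : coord) (f : R -> R -> R -> R) (u v w : R) : R -> R :=
  match a with
  | Cu => fun t => f t v w
  | Cv => fun t => f u t w
  | Cw => fun t => f u v t
  end.

Definition coord_val (a : coord) (u v w : R) : R :=
  match a with Cu => u | Cv => v | Cw => w end.

Definition partial (a : coord) (f : R -> R -> R -> R) (u v w : R) : R :=
  Derive (slice a f u v w) (coord_val a u v w).

Fixpoint iter_partial (l : list coord) (f : R -> R -> R -> R) : R -> R -> R -> R :=
  match l with
  | nil => f
  | cons a l' => partial a (iter_partial l' f)
  end.

(** Class C^oo: all iterated partial derivatives exist ([Derive] is total, so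
    existence is a separate clause) and are jointly continuous. *)
Definition smooth (f : R -> R -> R -> R) : Prop :=
  forall l : list coord,
    (forall (a : coord) (u v w : R),
        ex_derive (slice a (iter_partial l f) u v w) (coord_val a u v w)) /\
    (forall p : R * R * R,
        continuous (fun q : R * R * R => iter_partial l f (fst (fst q)) (snd (fst q)) (snd q)) p).

(** * Vector fields zeta d/du + eta d/dv + phi d/dw *)

Record vfield := VField {
  zeta : R -> R -> R -> R;
  eta : R -> R -> R -> R;
  phi : R -> R -> R -> R
}.

Definition smooth_vfield (X : vfield) : Prop :=
  smooth (zeta X) /\ smooth (eta X) /\ smooth (phi X).

Definition vzero : vfield :=
  VField (fun _ _ _ => 0) (fun _ _ _ => 0) (fun _ _ _ => 0).

Definition vadd (X Y : vfield) : vfield :=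
  VField (fun u v w => zeta X u v w + zeta Y u v w)
         (fun u v w => eta X u v w + eta Y u v w)
         (fun u v w => phi X u v w + phi Y u v w).

Definition vscal (c : R) (X : vfield) : vfield :=
  VField (fun u v w => c * zeta X u v w)
         (fun u v w => c * eta X u v w)
         (fun u v w => c * phi X u v w).

Definition lie_derivative (X : vfield) (f : R -> R -> R -> R) (u v w : R) : R :=
  zeta X u v w * partial Cu f u v w
  + eta X u v w * partial Cv f u v w
  + phi X u v w * partial Cw f u v w.

Definition lie_bracket (X Y : vfield) : vfield :=
  VField
    (fun u v w => lie_derivative X (zeta Y) u v w - lie_derivative Y (zeta X) u v w)
    (fun u v w => lie_derivative X (eta Y) u v w - lie_derivative Y (eta X) u v w)
    (fun u v w => lie_derivative X (phi Y) u v w - lie_derivative Y (phi X) u v w).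

Definition lie_algebra_of_vfields (A : vfield -> Prop) : Prop :=
  (forall X, A X -> smooth_vfield X) /\
  A vzero /\
  (forall X Y, A X -> A Y -> A (vadd X Y)) /\
  (forall c X, A X -> A (vscal c X)) /\
  (forall X Y, A X -> A Y -> A (lie_bracket X Y)).

(** * Jets and total derivatives *)

(** A point of the infinite jet space: [jet_w z i j] is the coordinate
    w_{u^i v^j} (so [jet_w z 0 0] is w itself).  Functions of order <= n are
    those depending only on u, v and the [jet_w z i j] with i + j <= n. *)
Record jet := Jet {
  jet_u : R;
  jet_v : R;
  jet_w : nat -> nat -> R
}.

Definition set_u (z : jet) (t : R) : jet := Jet t (jet_v z) (jet_w z).
Definition set_v (z : jet) (t : R) : jet := Jet (jet_u z) t (jet_w z).
Definition set_w (z : jet) (i j : nat) (t : R) : jet :=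
  Jet (jet_u z) (jet_v z)
      (fun i' j' => if andb (Nat.eqb i' i) (Nat.eqb j' j) then t else jet_w z i' j').

Definition d_u (F : jet -> R) (z : jet) : R :=
  Derive (fun t => F (set_u z t)) (jet_u z).
Definition d_v (F : jet -> R) (z : jet) : R :=
  Derive (fun t => F (set_v z t)) (jet_v z).
Definition d_w (i j : nat) (F : jet -> R) (z : jet) : R :=
  Derive (fun t => F (set_w z i j t)) (jet_w z i j).

(** [sum_upto_order n c] is the sum of [c i j] over i + j <= n. *)
Definition sum_upto_order (n : nat) (c : nat -> nat -> R) : R :=
  sum_f_R0 (fun k => sum_f_R0 (fun i => c i (k - i)%nat) k) n.

(** Total derivatives of a function [F] of order <= n; the result has order
    <= n + 1. *)
Definition total_u (n : nat) (F : jet -> R) (z : jet) : R :=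
  d_u F z + sum_upto_order n (fun i j => jet_w z (S i) j * d_w i j F z).
Definition total_v (n : nat) (F : jet -> R) (z : jet) : R :=
  d_v F z + sum_upto_order n (fun i j => jet_w z i (S j) * d_w i j F z).

Fixpoint iter_total (D : nat -> (jet -> R) -> jet -> R) (k n : nat) (F : jet -> R)
  : jet -> R :=
  match k with
  | O => F
  | S k' => D (n + k')%nat (iter_total D k' n F)
  end.

(** D_J = D_u^a D_v^b for the multi-index J = u^a v^b, on functions of
    order <= n. *)
Definition total_J (a b n : nat) (F : jet -> R) : jet -> R :=
  iter_total total_u a (n + b)%nat (iter_total total_v b n F).

(** * Second prolongation and infinitesimal symmetries *)

Definition at_jet (f : R -> R -> R -> R) (z : jet) : R :=
  f (jet_u z) (jet_v z) (jet_w z 0 0).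

Definition characteristic (X : vfield) (z : jet) : R :=
  at_jet (phi X) z - at_jet (zeta X) z * jet_w z 1 0 - at_jet (eta X) z * jet_w z 0 1.

(** The coefficient phi^J, J = u^a v^b.  The characteristic has order <= 1; the
    coordinates of order a + b + 1 cancel for smooth [X]. *)
Definition phi_J (X : vfield) (a b : nat) (z : jet) : R :=
  total_J a b 1 (characteristic X) z
  + at_jet (zeta X) z * jet_w z (S a) b
  + at_jet (eta X) z * jet_w z a (S b).

Definition pr2 (X : vfield) (Delta : jet -> R) (z : jet) : R :=
  at_jet (zeta X) z * d_u Delta z
  + at_jet (eta X) z * d_v Delta z
  + at_jet (phi X) z * d_w 0 0 Delta z
  + phi_J X 1 0 z * d_w 1 0 Delta z
  + phi_J X 0 1 z * d_w 0 1 Delta z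
  + phi_J X 2 0 z * d_w 2 0 Delta z
  + phi_J X 1 1 z * d_w 1 1 Delta z
  + phi_J X 0 2 z * d_w 0 2 Delta z.

(** Meaningful for [Delta] of order <= 2. *)
Definition infinitesimal_symmetry (Delta : jet -> R) (X : vfield) : Prop :=
  smooth_vfield X /\ forall z : jet, Delta z = 0 -> pr2 X Delta z = 0.

(** * The Titeica equation *)

Definition titeica (z : jet) : R :=
  jet_w z 1 1 - (exp (jet_w z 0 0) - exp (- 2 * jet_w z 0 0)).

Definition U1 : vfield := VField (fun u _ _ => u) (fun _ v _ => - v) (fun _ _ _ => 0).
Definition U2 : vfield := VField (fun _ _ _ => 1) (fun _ _ _ => 0) (fun _ _ _ => 0).
Definition U3 : vfield := VField (fun _ _ _ => 0) (fun _ _ _ => 1) (fun _ _ _ => 0).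

(* Main.v *)
(** Collecting the coefficients of [w_uu], [w_vv], [w_u], [w_v] and [w_u w_v] in
    the linearised equation shows that [zeta] depends on [u] only, [eta] on [v]
    only, and [phi] is affine in [w].  What remains, at fixed [(u, v)], is a linear
    relation between [1], [e^w], [e^(-2w)], [w e^w] and [w e^(-2w)]; its Taylor
    coefficients at [0] force [phi = 0] and [zeta_u + eta_v = 0], and the last
    equation separates the variables. *)

Require Import Defs.
From Stdlib Require Import Reals List Lra FunctionalExtensionality.
From Coquelicot Require Import Coquelicot.
Open Scope R_scope.

(** * Smooth functions and the affine family *)

Lemma smooth_ex_derive (f : R -> R -> R -> R) (a : coord) (u v w : R) :
  smooth f -> ex_derive (slice a f u v w) (coord_val a u v w).
Proof. intros Hf. exact (proj1 (Hf nil) a u v w). Qed.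

(** The head of the list is the outermost derivative, so a derivative taken first sits at the end;
    smoothness therefore passes to partial derivatives. *)
Lemma iter_partial_app (l1 l2 : list coord) (f : R -> R -> R -> R) :
  iter_partial (l1 ++ l2) f = iter_partial l1 (iter_partial l2 f).
Proof. induction l1 as [|a l1 IH]; simpl; [reflexivity | now rewrite IH]. Qed.

Lemma smooth_partial (a : coord) (f : R -> R -> R -> R) :
  smooth f -> smooth (partial a f).
Proof.
  intros Hf l.
  change (partial a f) with (iter_partial (a :: nil) f).
  rewrite <- iter_partial_app.
  apply Hf.
Qed.

(** A family closed under all partial derivatives that contains the components of [U1], [U2], [U3];
    it makes their smoothness and brackets computable. *)
Definition affine (a b c d : R) (u v w : R) : R := a * u + b * v + c * w + d.

Lemma is_derive_affine_slice (i : coord) (a b c d u v w : R) :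
  is_derive (slice i (affine a b c d) u v w) (coord_val i u v w)
    (match i with Cu => a | Cv => b | Cw => c end).
Proof. destruct i; simpl; unfold affine; auto_derive; trivial; apply Rmult_1_r. Qed.

Lemma partial_affine (i : coord) (a b c d : R) :
  partial i (affine a b c d) =
  affine 0 0 0 (match i with Cu => a | Cv => b | Cw => c end).
Proof.
  apply functional_extensionality; intro u.
  apply functional_extensionality; intro v.
  apply functional_extensionality; intro w.
  unfold partial.
  rewrite (is_derive_unique _ _ _ (is_derive_affine_slice i a b c d u v w)).
  unfold affine; destruct i; ring.
Qed.

Lemma iter_partial_affine (l : list coord) (a b c d : R) :
  exists a' b' c' d', iter_partial l (affine a b c d) = affine a' b' c' d'.
Proof.
  induction l as [|i l (a' & b' & c' & d' & IH)]; simpl.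
  - now exists a, b, c, d.
  - rewrite IH, partial_affine. eauto.
Qed.

Lemma smooth_affine (a b c d : R) : smooth (affine a b c d).
Proof.
  intro l.
  destruct (iter_partial_affine l a b c d) as (a' & b' & c' & d' & ->).
  split.
  - intros i u v w. eexists. apply is_derive_affine_slice.
  - intro p. unfold affine.
    assert (Hu : continuous (fun q : R * R * R => fst (fst q)) p)
      by (apply (continuous_comp fst fst); apply continuous_fst).
    assert (Hv : continuous (fun q : R * R * R => snd (fst q)) p)
      by (apply (continuous_comp fst snd); [apply continuous_fst | apply continuous_snd]).
    assert (Hw : continuous (fun q : R * R * R => snd q) p) by apply continuous_snd.
    assert (Hscal : forall (k : R) (f : R * R * R -> R),
               continuous f p -> continuous (fun q => k * f q) p)
      by (intros; now apply (continuous_scal_r (V := R_NormedModule))).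
    apply (continuous_plus (V := R_NormedModule)); [ | apply continuous_const].
    apply (continuous_plus (V := R_NormedModule)); [ | now apply Hscal].
    apply (continuous_plus (V := R_NormedModule)); now apply Hscal.
Qed.

(** * The prolongation coefficient of the mixed derivative *)

Lemma is_derive_plus_scal (f g : R -> R) (a x df dg : R) :
  is_derive f x df -> is_derive g x dg ->
  is_derive (fun t => f t + g t * a) x (df + dg * a).
Proof.
  intros Hf Hg.
  apply (is_derive_plus (V := R_NormedModule)); [exact Hf | ].
  now apply (is_derive_scal_l (V := R_NormedModule)).
Qed.

Lemma is_derive_minus_scal (f g : R -> R) (a x df dg : R) :
  is_derive f x df -> is_derive g x dg ->
  is_derive (fun t => f t - g t * a) x (df - dg * a).
Proof.
  intros Hf Hg.
  apply (is_derive_minus (V := R_NormedModule)); [exact Hf | ].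
  now apply (is_derive_scal_l (V := R_NormedModule)).
Qed.

(** The number, order and signs of the terms are those of [total_v_characteristic], to which the
    second total derivative is applied. *)
Lemma Derive_lin8 (f1 f2 f3 f4 f5 f6 f7 f8 : R -> R) (a2 a3 a4 a5 a6 a7 a8 x : R) :
  ex_derive f1 x -> ex_derive f2 x -> ex_derive f3 x -> ex_derive f4 x ->
  ex_derive f5 x -> ex_derive f6 x -> ex_derive f7 x -> ex_derive f8 x ->
  Derive (fun t => f1 t - f2 t * a2 - f3 t * a3 + f4 t * a4 - f5 t * a5 - f6 t * a6
                   - f7 t * a7 - f8 t * a8) x =
  Derive f1 x - Derive f2 x * a2 - Derive f3 x * a3 + Derive f4 x * a4
  - Derive f5 x * a5 - Derive f6 x * a6 - Derive f7 x * a7 - Derive f8 x * a8.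
Proof.
  intros. apply is_derive_unique.
  repeat first [ apply is_derive_minus_scal | apply is_derive_plus_scal ];
    now apply Derive_correct.
Qed.

Lemma Derive_lin3 (f1 f2 f3 : R -> R) (a2 a3 x : R) :
  ex_derive f1 x -> ex_derive f2 x -> ex_derive f3 x ->
  Derive (fun t => f1 t - f2 t * a2 - f3 t * a3) x =
  Derive f1 x - Derive f2 x * a2 - Derive f3 x * a3.
Proof.
  intros. apply is_derive_unique.
  repeat apply is_derive_minus_scal; now apply Derive_correct.
Qed.

(** Each term is kept as a function of [(u, v, w)] times a monomial in the derivatives of [w], so
    that the next total derivative acts term by term. *)
Lemma total_v_characteristic (X : vfield) (z : jet) :
  smooth_vfield X ->
  total_v 1 (characteristic X) z =
  at_jet (partial Cv (phi X)) z
  - at_jet (partial Cv (zeta X)) z * jet_w z 1 0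
  - at_jet (partial Cv (eta X)) z * jet_w z 0 1
  + at_jet (partial Cw (phi X)) z * jet_w z 0 1
  - at_jet (partial Cw (zeta X)) z * (jet_w z 1 0 * jet_w z 0 1)
  - at_jet (partial Cw (eta X)) z * (jet_w z 0 1 * jet_w z 0 1)
  - at_jet (eta X) z * jet_w z 0 2
  - at_jet (zeta X) z * jet_w z 1 1.
Proof.
  destruct X as [ze et ph]; intros (Hz & He & Hp); simpl in Hz, He, Hp.
  destruct z as [u v W].
  unfold total_v, sum_upto_order, sum_f_R0, d_v, d_w, characteristic, at_jet, set_v, set_w.
  cbn -[Rplus Rmult Rminus].
  rewrite (Derive_lin3 (fun t => ph u t (W 0%nat 0%nat))
     (fun t => ze u t (W 0%nat 0%nat)) (fun t => et u t (W 0%nat 0%nat)))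
   by (apply (smooth_ex_derive _ Cv u v (W 0%nat 0%nat)); assumption).
  rewrite (Derive_lin3 (ph u v) (ze u v) (et u v))
   by (apply (smooth_ex_derive _ Cw u v (W 0%nat 0%nat)); assumption).
  rewrite (is_derive_unique
    (fun t => ph u v (W 0%nat 0%nat) - ze u v (W 0%nat 0%nat) * W 1%nat 0%nat
       - et u v (W 0%nat 0%nat) * t) _ (- et u v (W 0%nat 0%nat)))
   by (auto_derive; trivial; ring).
  rewrite (is_derive_unique
    (fun t => ph u v (W 0%nat 0%nat) - ze u v (W 0%nat 0%nat) * t
       - et u v (W 0%nat 0%nat) * W 0%nat 1%nat) _ (- ze u v (W 0%nat 0%nat)))
   by (auto_derive; trivial; ring).
  unfold partial, slice, coord_val.
  change (fun t => ph u v t) with (ph u v).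
  change (fun t => ze u v t) with (ze u v).
  change (fun t => et u v t) with (et u v).
  ring.
Qed.

(** Apply [D_u] to the previous formula: the third order terms in [w_uuv] and [w_uvv] cancel against
    those added in [phi_J]. Mixed partial derivatives stay in the order in which they arise. *)
Lemma phi_uv_formula (X : vfield) (z : jet) :
  smooth_vfield X ->
  phi_J X 1 1 z =
  at_jet (partial Cu (partial Cv (phi X))) z
  - at_jet (partial Cu (partial Cv (zeta X))) z * jet_w z 1 0
  - at_jet (partial Cu (partial Cv (eta X))) z * jet_w z 0 1
  + at_jet (partial Cu (partial Cw (phi X))) z * jet_w z 0 1
  - at_jet (partial Cu (partial Cw (zeta X))) z * (jet_w z 1 0 * jet_w z 0 1)
  - at_jet (partial Cu (partial Cw (eta X))) z * (jet_w z 0 1 * jet_w z 0 1)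
  - at_jet (partial Cu (eta X)) z * jet_w z 0 2
  - at_jet (partial Cu (zeta X)) z * jet_w z 1 1
  + jet_w z 1 0 *
    (at_jet (partial Cw (partial Cv (phi X))) z
     - at_jet (partial Cw (partial Cv (zeta X))) z * jet_w z 1 0
     - at_jet (partial Cw (partial Cv (eta X))) z * jet_w z 0 1
     + at_jet (partial Cw (partial Cw (phi X))) z * jet_w z 0 1
     - at_jet (partial Cw (partial Cw (zeta X))) z * (jet_w z 1 0 * jet_w z 0 1)
     - at_jet (partial Cw (partial Cw (eta X))) z * (jet_w z 0 1 * jet_w z 0 1)
     - at_jet (partial Cw (eta X)) z * jet_w z 0 2
     - at_jet (partial Cw (zeta X)) z * jet_w z 1 1)
  - jet_w z 2 0 *
    (at_jet (partial Cv (zeta X)) z + at_jet (partial Cw (zeta X)) z * jet_w z 0 1)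
  + jet_w z 1 1 *
    (at_jet (partial Cw (phi X)) z - at_jet (partial Cv (eta X)) z
     - at_jet (partial Cw (zeta X)) z * jet_w z 1 0
     - 2 * at_jet (partial Cw (eta X)) z * jet_w z 0 1).
Proof.
  intro HX.
  unfold phi_J, total_J, iter_total.
  change (1 + 0)%nat with 1%nat. change (1 + 1 + 0)%nat with 2%nat.
  (* The formula for [D_v] sits under the outer [D_u], so it is needed as an equality of functions
     on jets. *)
  rewrite (functional_extensionality _ _ (fun z => total_v_characteristic X z HX)).
  destruct X as [ze et ph]; destruct HX as (Hz & He & Hp); simpl in Hz, He, Hp.
  destruct z as [u v W].
  unfold total_u, sum_upto_order, sum_f_R0, d_u, d_w, at_jet, set_u, set_w.
  cbn -[Rplus Rmult Rminus partial].
  set (w := W 0%nat 0%nat).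
  rewrite (Derive_lin8 (fun t => partial Cv ph t v w) (fun t => partial Cv ze t v w)
     (fun t => partial Cv et t v w) (fun t => partial Cw ph t v w)
     (fun t => partial Cw ze t v w) (fun t => partial Cw et t v w)
     (fun t => et t v w) (fun t => ze t v w))
   by (apply (smooth_ex_derive _ Cu u v w); auto using smooth_partial).
  rewrite (Derive_lin8 (fun t => partial Cv ph u v t) (fun t => partial Cv ze u v t)
     (fun t => partial Cv et u v t) (fun t => partial Cw ph u v t)
     (fun t => partial Cw ze u v t) (fun t => partial Cw et u v t)
     (fun t => et u v t) (fun t => ze u v t))
   by (apply (smooth_ex_derive _ Cw u v w); auto using smooth_partial).
  repeat match goal with
  | |- context [Derive (fun t => ?f t v w) u] =>
    change (Derive (fun t => f t v w) u) with (partial Cu f u v w)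
  | |- context [Derive (fun t => ?f u v t) w] =>
    change (Derive (fun t => f u v t) w) with (partial Cw f u v w)
  end.
  (* With the coefficient values made opaque constants, the remaining derivatives are those of
     polynomials in one jet coordinate. *)
  repeat match goal with |- context [partial ?a ?f u v w] =>
    generalize (partial a f u v w); intro
  end.
  generalize (ze u v w) (et u v w); intros.
  repeat match goal with |- context [W ?i ?j * Derive ?f (W ?i' ?j')] =>
    let E := fresh in
    eassert (E : Derive f (W i' j') = _)
      by (apply is_derive_unique; auto_derive; [trivial | reflexivity]);
    rewrite E; clear E
  end.
  ring.
Qed.

(** [titeica] involves only [w] and [w_uv], so only [phi] and the coefficient of [w_uv] survive. *)
Lemma pr2_titeica (X : vfield) (z : jet) :
  pr2 X titeica z =
  phi_J X 1 1 z
  - at_jet (phi X) z * (exp (jet_w z 0 0) + 2 * exp (- 2 * jet_w z 0 0)).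
Proof.
  destruct z as [u v W].
  unfold pr2, d_u, d_v, d_w, titeica, set_u, set_v, set_w.
  cbn -[Rplus Rmult Rminus Ropp phi_J at_jet].
  rewrite !Derive_const.
  generalize (W 1%nat 1%nat) (W 0%nat 0%nat); intros r w.
  rewrite (is_derive_unique (fun t => t - _) r 1) by (auto_derive; trivial; ring).
  rewrite (is_derive_unique (fun t : R => r - (exp t - exp (- 2 * t))) w
    (- (exp w + 2 * exp (- 2 * w)))) by (auto_derive; trivial; ring).
  ring.
Qed.

(** * Exponential relations and vanishing derivatives *)

(** Differentiation preserves the shape of the relation and acts linearly on its coefficients; the
    leading [0] keeps that shape, so the lemma can be iterated. *)
Lemma exp_relation_derive (c k1 a1 k2 a2 : R) :
  (forall w, c + (k1 + a1 * w) * exp w + (k2 + a2 * w) * exp (- 2 * w) = 0) ->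
  forall w, 0 + ((k1 + a1) + a1 * w) * exp w
            + ((a2 - 2 * k2) + (- 2 * a2) * w) * exp (- 2 * w) = 0.
Proof.
  intros H w.
  assert (E : Derive (fun w => c + (k1 + a1 * w) * exp w
                               + (k2 + a2 * w) * exp (- 2 * w)) w = 0).
  { rewrite (Derive_ext _ (fun _ => 0)) by exact H. apply Derive_const. }
  etransitivity; [symmetry | exact E].
  apply is_derive_unique. auto_derive; trivial. ring.
Qed.

Lemma exp_relation_trivial (c k a b : R) :
  (forall w, c + k * (exp w - exp (- 2 * w))
             = (a * w + b) * (exp w + 2 * exp (- 2 * w))) ->
  k = 0 /\ a = 0 /\ b = 0.
Proof.
  intro H.
  assert (H0 : forall w, c + ((k - b) + (- a) * w) * exp w
                 + ((- k - 2 * b) + (- 2 * a) * w) * exp (- 2 * w) = 0).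
  { intro w. specialize (H w). lra. }
  pose proof (exp_relation_derive _ _ _ _ _ H0) as H1.
  pose proof (exp_relation_derive _ _ _ _ _ H1) as H2.
  pose proof (exp_relation_derive _ _ _ _ _ H2) as H3.
  (* At 0 the three derivatives give, up to nonzero factors, [k + b - a = 0], [k + 3b - 2a = 0] and
     [3k + 5b - 9a = 0], a nonsingular system. *)
  specialize (H1 0); specialize (H2 0); specialize (H3 0).
  replace (- 2 * 0) with 0 in * by ring.
  rewrite exp_0 in *.
  lra.
Qed.

Lemma affine_of_constant_derivative (f : R -> R) (k : R) :
  (forall t, is_derive f t k) -> forall t, f t = k * t + f 0.
Proof.
  intros Hf t.
  destruct (MVT_gen f 0 t (fun _ => k)) as (x & _ & E).
  - intros; apply Hf.
  - intros s _. apply continuity_pt_filterlim, (ex_derive_continuous (V := R_NormedModule)).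
    now exists k.
  - lra.
Qed.

Lemma partial_zero_const (a : coord) (f : R -> R -> R -> R) :
  smooth f -> (forall u v w, partial a f u v w = 0) ->
  forall u v w t, slice a f u v w t = slice a f u v w (coord_val a u v w).
Proof.
  intros Hf H u v w t.
  assert (D : forall s, is_derive (slice a f u v w) s 0).
  { intro s.
    destruct a; simpl in *.
    - rewrite <- (H s v w). apply Derive_correct, (smooth_ex_derive f Cu s v w Hf).
    - rewrite <- (H u s w). apply Derive_correct, (smooth_ex_derive f Cv u s w Hf).
    - rewrite <- (H u v s). apply Derive_correct, (smooth_ex_derive f Cw u v s Hf). }
  rewrite (affine_of_constant_derivative _ 0 D t),
    (affine_of_constant_derivative _ 0 D (coord_val a u v w)).
  ring.
Qed.

(** * Determining equations *)

(** On the solution set [w_uv] is fixed to [r], while [p], [q], [a], [b], the values of [w_u],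
    [w_v], [w_uu], [w_vv], remain free. *)
Lemma determining_equation (X : vfield) (u v w p q a b : R) :
  infinitesimal_symmetry titeica X ->
  let r := exp w - exp (- 2 * w) in
  partial Cu (partial Cv (phi X)) u v w
  - partial Cu (partial Cv (zeta X)) u v w * p
  - partial Cu (partial Cv (eta X)) u v w * q
  + partial Cu (partial Cw (phi X)) u v w * q
  - partial Cu (partial Cw (zeta X)) u v w * (p * q)
  - partial Cu (partial Cw (eta X)) u v w * (q * q)
  - partial Cu (eta X) u v w * b
  - partial Cu (zeta X) u v w * r
  + p * (partial Cw (partial Cv (phi X)) u v w
         - partial Cw (partial Cv (zeta X)) u v w * p
         - partial Cw (partial Cv (eta X)) u v w * q
         + partial Cw (partial Cw (phi X)) u v w * q
         - partial Cw (partial Cw (zeta X)) u v w * (p * q)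
         - partial Cw (partial Cw (eta X)) u v w * (q * q)
         - partial Cw (eta X) u v w * b
         - partial Cw (zeta X) u v w * r)
  - a * (partial Cv (zeta X) u v w + partial Cw (zeta X) u v w * q)
  + r * (partial Cw (phi X) u v w - partial Cv (eta X) u v w
         - partial Cw (zeta X) u v w * p
         - 2 * partial Cw (eta X) u v w * q)
  = phi X u v w * (exp w + 2 * exp (- 2 * w)).
Proof.
  intros [HX Hsym] r.
  (* A jet with the prescribed coordinates up to order two; those of higher order get the default 0
     and do not occur in the formula. *)
  set (W := fun i j : nat =>
    match i, j with
    | O, O => w | S O, O => p | O, S O => q
    | S (S O), O => a | S O, S O => r | O, S (S O) => b
    | _, _ => 0
    end).
  assert (Hz : titeica (Jet u v W) = 0) by (apply Rminus_diag_eq; reflexivity).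
  specialize (Hsym _ Hz).
  rewrite pr2_titeica, (phi_uv_formula X _ HX) in Hsym.
  unfold at_jet in Hsym; cbn -[Rplus Rmult Rminus Ropp partial] in Hsym.
  apply Rminus_diag_uniq in Hsym.
  exact Hsym.
Qed.

Lemma partial_eq_zero (a : coord) (f : R -> R -> R -> R) :
  (forall u v w, f u v w = 0) -> forall u v w, partial a f u v w = 0.
Proof.
  intros H u v w. unfold partial.
  rewrite (Derive_ext _ (fun _ => 0)).
  - apply Derive_const.
  - intro t; destruct a; apply H.
Qed.

(* Independence of the coordinate [a] passes to [partial b f] pointwise, so the
   partial derivatives need not be commuted. *)
Lemma partial_partial_eq_zero (a b : coord) (f : R -> R -> R -> R) :
  smooth f -> (forall u v w, partial a f u v w = 0) ->
  forall u v w, partial a (partial b f) u v w = 0.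
Proof.
  intros Hf H u v w.
  transitivity (Derive (fun _ : R => partial b f u v w) (coord_val a u v w));
    [ | apply Derive_const].
  destruct a, b; try (rewrite Derive_const; apply partial_eq_zero; exact H);
    apply Derive_ext; intro t; apply Derive_ext; intro s;
    first [ exact (partial_zero_const _ f Hf H s v w t)
          | exact (partial_zero_const _ f Hf H u s w t)
          | exact (partial_zero_const _ f Hf H u v s t) ].
Qed.

Lemma symmetry_zeta_eta (X : vfield) :
  infinitesimal_symmetry titeica X ->
  (forall u v w, partial Cv (zeta X) u v w = 0) /\
  (forall u v w, partial Cw (zeta X) u v w = 0) /\
  (forall u v w, partial Cu (eta X) u v w = 0) /\
  (forall u v w, partial Cw (eta X) u v w = 0).
Proof.
  intro HX.
  repeat split; intros u v w;
    pose proof (fun p q a b => determining_equation X u v w p q a b HX) as D;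
    cbv zeta in D;
    (* The coefficient of [a] is [-(zeta_v + zeta_w q)] and that of [b] is [-(eta_u + eta_w p)].
       Differences in [a] at [q = 0, 1] and in [b] at [p = 0, 1] isolate the four derivatives. *)
    pose proof (D 0 0 0 0); pose proof (D 0 0 1 0); pose proof (D 0 1 0 0);
    pose proof (D 0 1 1 0); pose proof (D 0 0 0 1); pose proof (D 1 0 0 0);
    pose proof (D 1 0 0 1); lra.
Qed.

Lemma symmetry_reduced_equation (X : vfield) :
  infinitesimal_symmetry titeica X ->
  forall u v w p q,
  partial Cu (partial Cv (phi X)) u v w
  + partial Cu (partial Cw (phi X)) u v w * q
  + partial Cw (partial Cv (phi X)) u v w * p
  + partial Cw (partial Cw (phi X)) u v w * (p * q)
  + (exp w - exp (- 2 * w)) *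
    (partial Cw (phi X) u v w - partial Cu (zeta X) u v w - partial Cv (eta X) u v w)
  = phi X u v w * (exp w + 2 * exp (- 2 * w)).
Proof.
  intros HX u v w p q.
  destruct (symmetry_zeta_eta X HX) as (Zv & Zw & Eu & Ew).
  assert (He : smooth (eta X)) by apply HX.
  (* The coefficients of [a] and [b] vanish by now, so both are set to 0. *)
  rewrite <- (determining_equation X u v w p q 0 0 HX).
  rewrite (partial_eq_zero Cu _ Zv), (partial_eq_zero Cu _ Zw),
    (partial_eq_zero Cu _ Ew), (partial_eq_zero Cw _ Zv), (partial_eq_zero Cw _ Zw),
    (partial_eq_zero Cw _ Ew), (partial_partial_eq_zero Cu Cv _ He Eu),
    (partial_partial_eq_zero Cw Cv _ He Ew), Zv, Zw, Eu, Ew.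
  ring.
Qed.

(** The coefficients of [p] and [p q] give [phi_vw = phi_ww = 0]. At [p = q = 0] the rest is, for
    fixed [(u, v)], the relation of [exp_relation_trivial]. *)
Lemma symmetry_phi (X : vfield) :
  infinitesimal_symmetry titeica X ->
  (forall u v w, phi X u v w = 0) /\
  (forall u v w, partial Cu (zeta X) u v w + partial Cv (eta X) u v w = 0).
Proof.
  intro HX.
  pose proof (symmetry_reduced_equation X HX) as D.
  destruct (symmetry_zeta_eta X HX) as (Zv & Zw & Eu & Ew).
  destruct HX as [(Hz & He & Hp) _].
  assert (Pvw : forall u v w, partial Cw (partial Cv (phi X)) u v w = 0).
  { intros u v w. pose proof (D u v w 0 0). pose proof (D u v w 1 0). lra. }
  assert (Pww : forall u v w, partial Cw (partial Cw (phi X)) u v w = 0).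
  { intros u v w. pose proof (D u v w 0 0). pose proof (D u v w 1 0).
    pose proof (D u v w 0 1). pose proof (D u v w 1 1). lra. }
  (* All coefficients are frozen at [w = 0], so that [w] enters only through the exponentials and
     the affine factor [phi]. *)
  assert (E : forall u v w,
    partial Cu (partial Cv (phi X)) u v 0
    + (partial Cw (phi X) u v 0 - partial Cu (zeta X) u v 0 - partial Cv (eta X) u v 0)
      * (exp w - exp (- 2 * w))
    = (partial Cw (phi X) u v 0 * w + phi X u v 0) * (exp w + 2 * exp (- 2 * w))).
  { intros u v w.
    assert (Pw : forall t, partial Cw (phi X) u v t = partial Cw (phi X) u v 0)
      by exact (partial_zero_const Cw _ (smooth_partial Cw _ Hp) Pww u v 0).
    assert (Puv : partial Cu (partial Cv (phi X)) u v w
                  = partial Cu (partial Cv (phi X)) u v 0).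
    { apply Derive_ext; intro t; simpl.
      exact (partial_zero_const Cw _ (smooth_partial Cv _ Hp) Pvw t v 0 w). }
    assert (Zu : partial Cu (zeta X) u v w = partial Cu (zeta X) u v 0).
    { apply Derive_ext; intro t. exact (partial_zero_const Cw _ Hz Zw t v 0 w). }
    assert (Ev : partial Cv (eta X) u v w = partial Cv (eta X) u v 0).
    { apply Derive_ext; intro t. exact (partial_zero_const Cw _ He Ew u t 0 w). }
    assert (P : phi X u v w = partial Cw (phi X) u v 0 * w + phi X u v 0).
    { set (k := partial Cw (phi X) u v 0) in *.
      apply (affine_of_constant_derivative (phi X u v) k).
      intro t. rewrite <- (Pw t).
      apply Derive_correct, (smooth_ex_derive _ Cw u v t Hp). }
    rewrite <- P, <- (D u v w 0 0), (Pw w), Puv, Zu, Ev. ring. }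
  assert (T : forall u v, partial Cu (zeta X) u v 0 + partial Cv (eta X) u v 0 = 0 /\
    partial Cw (phi X) u v 0 = 0 /\ phi X u v 0 = 0).
  { intros u v. pose proof (exp_relation_trivial _ _ _ _ (E u v)). lra. }
  (* The vanishing at [w = 0] spreads to all [w]: [phi_w] is independent of [w], hence zero, and
     [phi] is then constant in [w]. *)
  assert (P0 : forall u v w, phi X u v w = 0).
  { intros u v w.
    rewrite <- (proj2 (proj2 (T u v))).
    assert (Pw : forall t, partial Cw (phi X) u v t = 0).
    { intro t. rewrite <- (proj1 (proj2 (T u v))).
      exact (partial_zero_const Cw _ (smooth_partial Cw _ Hp) Pww u v 0 t). }
    rewrite (affine_of_constant_derivative (phi X u v) 0); [ring | ].
    intro t. rewrite <- (Pw t).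
    apply Derive_correct, (smooth_ex_derive _ Cw u v t Hp). }
  split; [exact P0 | ].
  intros u v w.
  rewrite <- (proj1 (T u v)). f_equal; apply Derive_ext; intro t.
  - exact (partial_zero_const Cw _ Hz Zw t v 0 w).
  - exact (partial_zero_const Cw _ He Ew u t 0 w).
Qed.

(** * Normal form of the symmetries and their Lie algebra *)

Lemma symmetry_form (X : vfield) :
  infinitesimal_symmetry titeica X ->
  exists c1 c2 c3 : R,
    X = VField (affine c1 0 0 c2) (affine 0 (- c1) 0 c3) (affine 0 0 0 0).
Proof.
  intro HX.
  destruct (symmetry_phi X HX) as [P S].
  destruct (symmetry_zeta_eta X HX) as (Zv & Zw & Eu & Ew).
  destruct HX as [(Hz & He & _) _].
  (* The coefficients of [U1], [U2], [U3], read off at the origin. *)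
  exists (partial Cu (zeta X) 0 0 0), (zeta X 0 0 0), (eta X 0 0 0).
  set (c1 := partial Cu (zeta X) 0 0 0).
  assert (Zs : forall u v w, zeta X u v w = zeta X u 0 0).
  { intros u v w. transitivity (zeta X u 0 w).
    - exact (partial_zero_const Cv _ Hz Zv u 0 w v).
    - exact (partial_zero_const Cw _ Hz Zw u 0 0 w). }
  assert (Es : forall u v w, eta X u v w = eta X 0 v 0).
  { intros u v w. transitivity (eta X 0 v w).
    - exact (partial_zero_const Cu _ He Eu 0 v w u).
    - exact (partial_zero_const Cw _ He Ew 0 v 0 w). }
  (* Separation of variables: [zeta_u] depends on [u] only and [eta_v] on [v] only, so
     [zeta_u = - eta_v] forces both to be constant. *)
  assert (Ev : forall v, partial Cv (eta X) 0 v 0 = - c1).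
  { intro v. assert (partial Cu (zeta X) 0 v 0 = c1)
      by (apply Derive_ext; intro t; simpl; rewrite Zs; reflexivity).
    specialize (S 0 v 0). lra. }
  assert (Zu : forall u, partial Cu (zeta X) u 0 0 = c1).
  { intro u. assert (partial Cv (eta X) u 0 0 = partial Cv (eta X) 0 0 0)
      by (apply Derive_ext; intro t; simpl; rewrite Es; reflexivity).
    specialize (S u 0 0). specialize (Ev 0). lra. }
  destruct X as [ze et ph]; simpl in *.
  f_equal; apply functional_extensionality; intro u;
    apply functional_extensionality; intro v;
    apply functional_extensionality; intro w; unfold affine.
  - rewrite Zs. rewrite (affine_of_constant_derivative (fun t => ze t 0 0) c1); [ring | ].
    intro t. rewrite <- (Zu t). apply Derive_correct, (smooth_ex_derive ze Cu t 0 0 Hz).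
  - rewrite Es. rewrite (affine_of_constant_derivative (fun t => et 0 t 0) (- c1)); [ring | ].
    intro t. rewrite <- (Ev t). apply Derive_correct, (smooth_ex_derive et Cv 0 t 0 He).
  - rewrite P. ring.
Qed.

(** Only [zeta_u] and [eta_v] contribute to the coefficient of [w_uv], through
    [-(zeta_u + eta_v) w_uv], and here [zeta_u + eta_v = c1 - c1]. *)
Lemma form_symmetry (c1 c2 c3 : R) :
  infinitesimal_symmetry titeica
    (VField (affine c1 0 0 c2) (affine 0 (- c1) 0 c3) (affine 0 0 0 0)).
Proof.
  assert (HX : smooth_vfield
    (VField (affine c1 0 0 c2) (affine 0 (- c1) 0 c3) (affine 0 0 0 0)))
    by (repeat split; apply smooth_affine).
  split; [exact HX | ].
  intros z _.
  rewrite pr2_titeica, (phi_uv_formula _ _ HX).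
  cbn [zeta eta phi].
  rewrite !partial_affine. unfold at_jet, affine. ring.
Qed.

Ltac vfield_ext :=
  unfold vzero, vadd, vscal, U1, U2, U3, affine; cbn [zeta eta phi]; f_equal;
  apply functional_extensionality; intro; apply functional_extensionality; intro;
  apply functional_extensionality; intro; ring.

Lemma symmetry_iff_form (X : vfield) :
  infinitesimal_symmetry titeica X <->
  exists c1 c2 c3 : R,
    X = VField (affine c1 0 0 c2) (affine 0 (- c1) 0 c3) (affine 0 0 0 0).
Proof.
  split; [apply symmetry_form | ].
  intros (c1 & c2 & c3 & ->). apply form_symmetry.
Qed.

Theorem theorem10 :
  lie_algebra_of_vfields (infinitesimal_symmetry titeica) /\
  (forall X : vfield,
     infinitesimal_symmetry titeica X <->
     exists c1 c2 c3 : R,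
       X = vadd (vadd (vscal c1 U1) (vscal c2 U2)) (vscal c3 U3)).
Proof.
  split; [split; [intros X HX; apply HX | ] | ].
  - split; [ | split; [intros X Y | split; [intros c X | intros X Y]]];
      rewrite !symmetry_iff_form.
    + exists 0, 0, 0. vfield_ext.
    + intros (a1 & a2 & a3 & ->) (b1 & b2 & b3 & ->).
      exists (a1 + b1), (a2 + b2), (a3 + b3). vfield_ext.
    + intros (a1 & a2 & a3 & ->).
      exists (c * a1), (c * a2), (c * a3). vfield_ext.
    + intros (a1 & a2 & a3 & ->) (b1 & b2 & b3 & ->).
      (* These come from [[U1, U2] = - U2], [[U1, U3] = U3] and [[U2, U3] = 0]. *)
      exists 0, (a2 * b1 - b2 * a1), (b3 * a1 - a3 * b1).
      unfold lie_bracket, lie_derivative; cbn [zeta eta phi].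
      rewrite !partial_affine. vfield_ext.
  - intro X. rewrite symmetry_iff_form.
    split; intros (c1 & c2 & c3 & ->); exists c1, c2, c3; vfield_ext.
Qed.
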